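(* Let $s,t\geq 1$ be integers and let $p,q,l$ be three distinct primes with $p,q$ odd, $p\equiv 3 \pmod 4$, $\mathrm{ord}_{p^s}(l)=\phi(p^s)/2$, $\mathrm{ord}_{q^t}(l)=\phi(q^t)$ and $\gcd(\phi(p^s),\phi(q^t))=2$. Let $0\leq i\leq s-1$ and $0\leq j<j'\leq t$. Then in the ring $\mathbb{F}_l[x]/\langle x^{p^sq^t}-1\rangle$: (i) If $q$ is a quadratic residue modulo $p$, then \[\chi_{ij}^*\chi_{ij'}^*=\frac{p-3}{4}p^{s-i-1}\phi(q^{t-j'})\chi_{ij}^*+\frac{p+1}{4}p^{s-i-1}\phi(q^{t-j'})\chi_{ij}.\] (ii) If $q$ is a quadratic nonresidue modulo $p$ and $2\mid j'-j$, then \[\chi_{ij}^*\chi_{ij'}^*=\frac{p-3}{4}p^{s-i-1}\phi(q^{t-j'})\chi_{ij}^*+\frac{p+1}{4}p^{s-i-1}\phi(q^{t-j'})\chi_{ij}.\] (iii) If $q$ is a quadratic nonresidue modulo $p$ and $2\nmid j'-j$, then \[\chi_{ij}^*\chi_{ij'}^*=\frac{p-3}{4}p^{s-i-1}\phi(q^{t-j'})(\chi_{ij}+\chi_{ij}^* )+\frac{\phi(p^{s-i})}{2}\phi(q^{t-j'})\Big(\sum_{i< k\leq s-1}(\chi_{kj}+\chi_{kj}^* )+\chi_{sj}\Big).\]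
   Context: Here $\phi$ is Euler's phi function (with $\phi(1)=1$) and $\mathrm{ord}_m(k)$ is the multiplicative order of $k$ modulo $m$. Put $n=p^sq^t$. Fix an integer $g$ that is a primitive root both modulo $p^s$ and modulo $q^t$. For an integer $\gamma$, $C_\gamma=\{\gamma l^r \bmod n: r\geq 0\}\subseteq \mathbb{Z}_n$ is the $l$-cyclotomic coset modulo $n$ containing $\gamma$. For $0\leq i\leq s$, $0\leq j\leq t$ set $C_{ij}=C_{p^iq^j}$ and $C_{ij}^*=C_{p^iq^jg}$; in particular $C_{sj}=C_{sj}^*$ and $C_{st}=C_0=\{0\}$. Define elements of $\mathbb{F}_l[x]/\langle x^{n}-1\rangle$ by $\chi_{ij}=\sum_{\alpha\in C_{ij}}x^\alpha$ and $\chi_{ij}^*=\sum_{\alpha\in C_{ij}^*}x^\alpha$; in particular $\chi_{sj}=\chi_{sj}^*$ and $\chi_{st}=1$. Integer coefficients are read in $\mathbb{F}_l$, and empty sums are $0$. *)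

(* Defs.v *)
From mathcomp Require Export all_boot all_order all_algebra.
From mathcomp Require Export qpoly.
Set Implicit Arguments.
Unset Strict Implicit.
Unset Printing Implicit Defensive.

Import GRing.Theory.
Local Open Scope ring_scope.

(* ord_m(k) = d, for m > 1: [d.-primitive_root z] says that d is the least
   positive exponent with z ^+ d = 1. *)
Definition has_order_mod (m : nat) (k : int) (d : nat) : Prop :=
  d.-primitive_root (k%:~R : 'Z_m).

(* A primitive root in the number-theoretic sense: order phi(m) modulo m. *)
Definition primitive_root_mod (m : nat) (g : int) : Prop :=
  has_order_mod m g (totient m).

Definition quadratic_residue (p a : nat) : Prop :=
  coprime a p /\ exists x : nat, (x ^ 2)%N = a %[mod p].

Definition quadratic_nonresidue (p a : nat) : Prop :=
  coprime a p /\ ~ exists x : nat, (x ^ 2)%N = a %[mod p].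

(* For n > 1, ['Z_n] is the ring of residues 0, ..., n - 1, and
   [gamma%:~R : 'Z_n] is gamma mod n. *)
Definition cyclotomic_coset (n l : nat) (gamma : int) : {set 'Z_n} :=
  [set a | fconnect (fun x : 'Z_n => x * l%:R) gamma%:~R a].

Lemma cyclotomic_cosetP (n l : nat) (gamma : int) (a : 'Z_n) :
  reflect (exists r : nat, a = gamma%:~R * l%:R ^+ r)
          (a \in cyclotomic_coset n l gamma).
Proof.
pose f (x : 'Z_n) := x * l%:R.
have iterE r x : iter r f x = x * l%:R ^+ r.
  by elim: r => [|r IHr]; rewrite ?mulr1 //= IHr /f exprSr mulrA.
rewrite inE; apply: (iffP idP) => [gamma_a | [r ->]].
  by exists (findex f gamma%:~R a); rewrite -iterE iter_findex.
by rewrite -iterE; apply: fconnect_iter.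
Qed.

Notation cyc_ring l n := {poly %/ ('X^n - 1 : {poly 'F_l})}.

(* [{poly %/ h}] really is the quotient by h only for h monic nonconstant. *)
Lemma mk_monic_Xn_sub1 (l n : nat) :
  (0 < n)%N -> mk_monic ('X^n - 1 : {poly 'F_l}) = 'X^n - 1.
Proof.
by move=> n_gt0; rewrite /mk_monic size_XnsubC // ltnS n_gt0 monicXnsubC.
Qed.

Definition coset_sum (n l : nat) (gamma : int) : cyc_ring l n :=
  \sum_(a in cyclotomic_coset n l gamma) in_qpoly ('X^n - 1) 'X^a.

Definition chi (p q s t l i j : nat) : cyc_ring l (p ^ s * q ^ t)%N :=
  coset_sum (p ^ s * q ^ t)%N l (p ^ i * q ^ j)%N%:Z.

Definition chi_star (p q s t l : nat) (g : int) (i j : nat) :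
    cyc_ring l (p ^ s * q ^ t)%N :=
  coset_sum (p ^ s * q ^ t)%N l ((p ^ i * q ^ j)%N%:Z * g).

(* Main.v *)
Require Import Defs.
From mathcomp Require Import all_boot all_order all_algebra.
From mathcomp Require Import all_field zify.
Import GRing.Theory.
Local Open Scope ring_scope.
Set Implicit Arguments.
Unset Strict Implicit.
Unset Printing Implicit Defensive.

(** Let n = p^s q^t. Modulo p^s the powers of l are exactly the units that are
squares mod p, modulo q^t they are all the units, and the two orders of l are
coprime; so, by the Chinese remainder theorem, the coset of p^i q^j u is the
product of the classes p^i v, with v of quadratic character (q/p)^j (u/p), and
of the classes of valuation exactly j modulo q^t. Write x = y z with
y^(p^s) = 1 and z^(q^t) = 1: the coset sums factor as psum(y) * qsum(z). Adding
a multiple of q^(j+1) preserves the valuation j, whence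
qsum_j * qsum_j' = phi(q^(t-j')) qsum_j. On the other side psum is
ptail(y) * sum_(r mod p) y^(p^i r), r ranging over a quadratic class, where
ptail is the sum over the multiples of p^(i+1) and satisfies
ptail^2 = p^(s-i-1) ptail; the products of psums are thus governed by the
cyclotomic numbers of order two of F_p, p = 4k+3, which are k, k and k+1. *)

(** * Cyclotomic numbers of order two *)

Section CyclotomicNumbers.
Variables (F : finFieldType) (k : nat).

(* The quadratic character when #|F| = 4k+3, with values in F itself. *)
Definition qchar (x : F) : F := x ^+ (2 * k).+1.

Lemma qcharM x y : qchar (x * y) = qchar x * qchar y.
Proof. by rewrite /qchar exprMn. Qed.

Lemma qcharX x r : qchar (x ^+ r) = qchar x ^+ r.
Proof. by rewrite /qchar exprAC. Qed.

Lemma qcharV x : qchar x^-1 = (qchar x)^-1.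
Proof. by rewrite /qchar exprVn. Qed.

Lemma qchar1 : qchar 1 = 1.
Proof. by rewrite /qchar expr1n. Qed.

Lemma qcharN x : qchar (- x) = - qchar x.
Proof. by rewrite /qchar exprNn -signr_odd /= oddM /= expr1 mulN1r. Qed.

Lemma qchar0 : qchar 0 = 0.
Proof. by rewrite /qchar expr0n. Qed.

Lemma qchar_eq0 x : (qchar x == 0) = (x == 0).
Proof. by rewrite /qchar expf_eq0. Qed.

Hypothesis cardF : #|F| = (4 * k).+3.

(** Since [2 * (2k+1) + 1] is the order of the field, this is Fermat's identity with one factor [x]
    cancelled. *)
Lemma qchar_sqr x : x != 0 -> qchar x ^+ 2 = 1.
Proof.
move=> x0; rewrite -exprM; apply: (mulfI x0); rewrite mulr1 -exprS.
rewrite -[RHS]expf_card cardF; congr (_ ^+ _); lia.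
Qed.

Lemma qchar_sign x : x != 0 -> (qchar x == 1) || (qchar x == -1).
Proof. by move=> x0; rewrite -sqrf_eq1 qchar_sqr. Qed.

(** If [x ^+ (2k+1) = 1] then [x ^+ (2k+2) = x], so [x ^+ (k+1)] is an explicit square root. *)
Lemma qchar_sqrtP x : reflect (exists2 y, y != 0 & x = y ^+ 2) (qchar x == 1).
Proof.
apply: (iffP eqP) => [x1 | [y y0 ->]]; last by rewrite qcharX qchar_sqr.
exists (x ^+ k.+1).
  by rewrite expf_neq0 // -qchar_eq0 x1 oner_eq0.
by rewrite -exprM mulSn addnC mulnC -[LHS]mulr1 -x1 -exprS; congr (_ ^+ _); lia.
Qed.

Hypothesis N1_neq1 : -1 != 1 :> F.

(** Negation exchanges the two classes because [qchar] is odd, and together they fill the [4k+2]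
    nonzero elements. *)
Lemma card_qchar e : e ^+ 2 = 1 -> #|[set a | qchar a == e]| = (2 * k).+1.
Proof.
move=> e2.
have eN: #|[set a | qchar a == -1]| = #|[set a | qchar a == 1]|.
  rewrite -(card_imset _ (@oppr_inj F)); congr #|pred_of_set _|.
  apply/setP => a; apply/imsetP/idP => [[b] | ].
    by rewrite !inE => /eqP b1 ->; rewrite qcharN b1 opprK.
  by rewrite inE => /eqP a1; exists (- a); rewrite ?opprK // inE qcharN a1.
have : (#|[set a | qchar a == 1%R]| + #|[set a | qchar a == -1%R]| = (4 * k).+2)%N.
  rewrite -cardsUI [X in (_ + X)%N](_ : _ = 0%N) ?addn0; last first.
    apply/eqP; rewrite cards_eq0 -subset0; apply/subsetP => a.
    by rewrite !inE => /andP[/eqP->]; rewrite eq_sym (negPf N1_neq1).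
  have /eqP := cardsC1 (0 : F); rewrite cardF /= => /eqP <-.
  congr #|pred_of_set _|; apply/setP => a; rewrite !inE.
  have [->|/qchar_sign //] := eqVneq a 0.
  by rewrite qchar0 eq_sym oner_eq0 eq_sym oppr_eq0 oner_eq0.
have /orP[/eqP->|/eqP->] : (e == 1) || (e == -1) by rewrite -sqrf_eq1 e2.
  by rewrite eN; lia.
by rewrite eN; lia.
Qed.

(* The cyclotomic numbers of order two are the values at c = 1. *)
Definition qrep e d c : nat :=
  #|[set a | (qchar a == e) && (qchar (c - a) == d)]|.

Lemma qrep_scale u e d c : u != 0 ->
  qrep (qchar u * e) (qchar u * d) (u * c) = qrep e d c.
Proof.
move=> u0; rewrite /qrep -[RHS](card_imset _ (mulfI u0)); congr #|pred_of_set _|.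
have qu0 : qchar u != 0 by rewrite qchar_eq0.
apply/setP => a; apply/idP/imsetP => [|[b]].
  rewrite inE => ha; exists (u^-1 * a); last by rewrite mulVKf.
  rewrite inE -(inj_eq (mulfI qu0)) -qcharM mulVKf //.
  by rewrite -[X in _ && X](inj_eq (mulfI qu0)) -qcharM mulrBr mulVKf.
by rewrite !inE => /andP[/eqP be /eqP bd] ->; rewrite -mulrBr !qcharM be bd !eqxx.
Qed.

Lemma qrep_sym e d c : qrep e d c = qrep d e c.
Proof.
rewrite /qrep -(card_imset _ (@subrI F c)); congr #|pred_of_set _|.
apply/setP => a; rewrite inE; apply/imsetP/idP => [[b] | /andP[ad ae]].
  by rewrite !inE => /andP[be bd] ->; rewrite subKr bd be.
by exists (c - a); rewrite ?subKr // !inE subKr ae ad.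
Qed.

(** Only [a = 1] makes [1 - a] vanish, and it lies in the class of [e] exactly when [e = 1]. *)
Lemma qrep_split e : e ^+ 2 = 1 ->
  (qrep e 1%R 1%R + qrep e (-1)%R 1%R + (e == 1%R) = (2 * k).+1)%N.
Proof.
move=> e2; rewrite -(card_qchar e2) /qrep -cardsUI.
rewrite [X in (_ + X + _)%N](_ : _ = 0%N) ?addn0; last first.
  apply/eqP; rewrite cards_eq0 -subset0; apply/subsetP => a.
  rewrite !inE => /andP[/andP[_ /eqP->] /andP[_]].
  by rewrite eq_sym (negPf N1_neq1).
rewrite (cardsD1 1 [set a | qchar a == e]) inE qchar1 eq_sym addnC.
congr (_ + _)%N; congr #|pred_of_set _|; apply/setP => a.
rewrite !inE -andb_orr andbC; congr (_ && _).
have [->|a1] := eqVneq a 1.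
  by rewrite subrr qchar0 eq_sym oner_eq0 eq_sym oppr_eq0 oner_eq0.
by rewrite qchar_sign // subr_eq0 eq_sym.
Qed.

(* Since -1 is a nonsquare, a |-> a^-1 maps the squares a with 1 - a a square
   onto the squares a with 1 - a a nonsquare. *)
Lemma qrep_inv : qrep 1 1 1 = qrep 1 (-1) 1.
Proof.
rewrite /qrep -(card_imset _ (@invr_inj F)); congr #|pred_of_set _|.
have flip a : qchar a = 1 -> qchar (1 - a^-1) = - qchar (1 - a).
  move=> a1; have a0 : a != 0 by rewrite -qchar_eq0 a1 oner_eq0.
  have -> : 1 - a^-1 = - (1 - a) * a^-1 by rewrite opprB mulrBl divff ?mul1r.
  by rewrite qcharM qcharV a1 invr1 mulr1 qcharN.
apply/setP => a; rewrite inE; apply/imsetP/idP => [[b] | /andP[/eqP a1 /eqP ad]].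
  rewrite !inE => /andP[/eqP b1 /eqP bd] ->.
  by rewrite flip // qcharV b1 bd invr1 !eqxx.
exists a^-1; last by rewrite invrK.
by rewrite !inE flip // qcharV a1 ad invr1 opprK !eqxx.
Qed.

(** Symmetry and inversion equate three of the four numbers; the two relations of [qrep_split] then
    determine all of them. *)
Lemma qrep1 e d : e ^+ 2 = 1 -> d ^+ 2 = 1 ->
  qrep e d 1 = (k + ((e == -1)%R && (d == -1)%R))%N.
Proof.
have s1 := qrep_split (expr1n F 2).
have s2 := qrep_split (etrans (sqrrN _) (expr1n F 2)).
have N1f : ((-1 : F) == 1) = false := negbTE N1_neq1.
have N1f' : ((1 : F) == -1) = false by rewrite eq_sym N1f.
move: s1 s2; rewrite (qrep_sym (-1) 1) -qrep_inv eqxx N1f => s1 s2.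
have s3 : qrep 1 1 1 = k by lia.
have s4 : qrep (-1) (-1) 1 = k.+1.
  by apply: (@addnI k); move: s2; rewrite s3 addn0 => ->; lia.
move=> /eqP; rewrite sqrf_eq1 => /orP[]/eqP-> /eqP;
  rewrite sqrf_eq1 => /orP[]/eqP->; rewrite ?eqxx ?N1f' /= ?addn0 ?addn1 //.
  by rewrite -qrep_inv.
by rewrite qrep_sym -qrep_inv.
Qed.

(** Scaling by [c^-1] reduces to [c = 1]; the signs get multiplied by [qchar c], which is its own
    inverse. *)
Lemma qrepE e d c : e ^+ 2 = 1 -> d ^+ 2 = 1 -> c != 0 ->
  qrep e d c = (k + ((e == - qchar c) && (d == - qchar c)))%N.
Proof.
move=> e2 d2 c0; have c2 := qchar_sqr c0.
rewrite -(@qrep_scale c^-1) ?invr_eq0 // mulVf // qcharV.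
have -> : (qchar c)^-1 = qchar c.
  by apply: (mulfI (_ : qchar c != 0)); rewrite ?qchar_eq0 // divff ?qchar_eq0.
rewrite qrep1 ?exprMn ?c2 ?e2 ?d2 ?mulr1 //.
by congr (_ + (_ && _))%N; rewrite -[in RHS](inj_eq (@mulfI _ (qchar c) _))
  ?qchar_eq0 // mulrN -expr2 c2.
Qed.

(** [a] and [0 - a] have opposite characters, so either the whole class of [e] counts or nothing
    does. *)
Lemma qrep0 e d : e ^+ 2 = 1 -> d ^+ 2 = 1 ->
  qrep e d 0 = ((d == - e) * (2 * k).+1)%N.
Proof.
move=> e2 d2; rewrite /qrep -(card_qchar e2).
have [->|de] := eqVneq d (- e).
  rewrite mul1n; apply: eq_card => a; rewrite !inE sub0r qcharN.
  by rewrite (inj_eq oppr_inj) andbb.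
rewrite mul0n; apply/eqP; rewrite cards_eq0 -subset0; apply/subsetP => a.
by rewrite !inE sub0r qcharN => /andP[/eqP-> ed]; rewrite eq_sym ed in de.
Qed.

Lemma sum_qchar_add (V : nmodType) (M : F -> V) e d :
  \sum_(a | qchar a == e) \sum_(b | qchar b == d) M (a + b)
  = \sum_c M c *+ qrep e d c.
Proof.
transitivity (\sum_(a | qchar a == e) \sum_(c | qchar (c - a) == d) M c).
  apply: eq_bigr => a _; rewrite (reindex_inj (addIr (- a))) /=.
  by apply: eq_bigr => c _; rewrite addrC subrK.
rewrite (exchange_big_dep predT) //=; apply: eq_bigr => c _.
by rewrite big_const iter_addr_0 /qrep cardsE.
Qed.

Lemma sign_neq_opp (e : F) : e ^+ 2 = 1 -> (e == - e) = false.
Proof.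
move=> /eqP; rewrite sqrf_eq1 => /orP[]/eqP->; last rewrite opprK.
  by rewrite eq_sym (negPf N1_neq1).
exact: negPf N1_neq1.
Qed.

Lemma sum_qchar (V : nmodType) (M : F -> V) e : e ^+ 2 = 1 ->
  \sum_c M c = M 0 + \sum_(c | qchar c == e) M c + \sum_(c | qchar c == - e) M c.
Proof.
move=> e2; have e0 : e != 0 by rewrite -sqrf_eq0 e2 oner_eq0.
have eNe := sign_neq_opp e2.
rewrite (bigD1 0) //= -addrA (bigID (fun c => qchar c == e)) /=; congr (_ + (_ + _)).
  apply: eq_bigl => c; case: eqVneq => [->|//].
  by rewrite qchar0 eq_sym (negPf e0).
apply: eq_bigl => c; case: (eqVneq c 0) => [->|c0].
  by rewrite qchar0 [0 == - e]eq_sym oppr_eq0 (negPf e0).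
have := qchar_sqr c0; rewrite -e2 => /eqP; rewrite eqf_sqr.
by case: (eqVneq (qchar c) e) => [->|_ /= ->] //; rewrite eNe.
Qed.

(** The sum 0 is never reached, as -1 is a nonsquare; the extra representation in [qrepE] goes to
    the class opposite to [e]. *)
Lemma sum_qchar_add_same (V : nmodType) (M : F -> V) e : e ^+ 2 = 1 ->
  \sum_(a | qchar a == e) \sum_(b | qchar b == e) M (a + b)
  = (\sum_(c | qchar c == e) M c) *+ k + (\sum_(c | qchar c == - e) M c) *+ k.+1.
Proof.
move=> e2; have e0 : e != 0 by rewrite -sqrf_eq0 e2 oner_eq0.
have eNe := sign_neq_opp e2.
rewrite sum_qchar_add (sum_qchar _ e2) qrep0 // eNe mul0n mulr0n add0r.
rewrite -!sumrMnl; congr (_ + _); apply: eq_bigr => c /eqP ce;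
  have c0: c != 0 by rewrite -qchar_eq0 ce ?oppr_eq0.
  by rewrite qrepE // ce eNe addn0.
by rewrite qrepE // ce opprK eqxx addn1.
Qed.

(** Here 0 is reached once for each [a], and the extra representation never occurs since it would
    need equal signs. *)
Lemma sum_qchar_add_opp (V : nmodType) (M : F -> V) e : e ^+ 2 = 1 ->
  \sum_(a | qchar a == e) \sum_(b | qchar b == - e) M (a + b)
  = (\sum_(c | qchar c == e) M c + \sum_(c | qchar c == - e) M c) *+ k
    + M 0 *+ (2 * k).+1.
Proof.
move=> e2; have e0 : e != 0 by rewrite -sqrf_eq0 e2 oner_eq0.
have eNe := sign_neq_opp e2.
rewrite sum_qchar_add (sum_qchar _ e2) qrep0 ?sqrrN // eqxx mul1n -addrA addrC.
rewrite mulrnDl -!sumrMnl; congr (_ + _ + _); apply: eq_bigr => c /eqP ce;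
  have c0: c != 0 by rewrite -qchar_eq0 ce ?oppr_eq0.
  by rewrite qrepE ?sqrrN // ce eNe addn0.
by rewrite qrepE ?sqrrN // ce opprK [- e == e]eq_sym eNe andbF addn0.
Qed.
End CyclotomicNumbers.

(** * Sums over residues *)

Section NatSums.
Variable V : nmodType.
Implicit Type f : nat -> V.

Lemma sum_nat_modn a b (B : pred nat) f :
    (forall w r, B (a * w + r)%N = B r) ->
  \sum_(0 <= u < a * b | B u) f u
  = \sum_(0 <= r < a | B r) \sum_(0 <= w < b) f (a * w + r)%N.
Proof.
move=> Bmod; rewrite big_mkcond mulnC big_nat_mul /=.
rewrite [RHS]big_mkcond.
transitivity (\sum_(0 <= w < b) \sum_(0 <= r < a | B r) f (a * w + r)%N).
  apply: eq_bigr => w _; rewrite -{1}[(w * a)%N]add0n big_addn mulSn addnK.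
  rewrite -big_mkcond /=.
  by apply: eq_big => r *; rewrite addnC mulnC ?Bmod.
by rewrite exchange_big /= big_mkcond.
Qed.

Lemma sum_nat_dvdn a b (B : pred nat) f : (0 < a)%N ->
  \sum_(0 <= u < a * b | (a %| u)%N && B (u %/ a)%N) f u
  = \sum_(0 <= w < b | B w) f (a * w)%N.
Proof.
move=> a0; rewrite big_mkcond sum_nat_modn //= exchange_big /= [RHS]big_mkcond.
apply: eq_bigr => w _; rewrite big_ltn // addn0 dvdn_mulr // mulKn //=.
rewrite big_nat big1 ?addr0 // => r /andP[r0 ra].
by rewrite dvdn_addr ?dvdn_mulr // gtnNdvd.
Qed.

Lemma sum_nat_shift n k f : (forall u, f (u + n)%N = f u) ->
  \sum_(0 <= u < n) f (u + k)%N = \sum_(0 <= u < n) f u.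
Proof.
move=> fn; elim: k => [|k <-]; first by apply: eq_bigr => u _; rewrite addn0.
case: n fn => [|n] fn; first by rewrite !big_nil.
rewrite big_nat_recr // [RHS]big_nat_recl //= add0n -addSnnS addnC fn addrC.
by congr (_ + _); apply: eq_bigr => u _; rewrite addSnnS.
Qed.

Lemma sum_nat_chinese P Q (f : nat -> nat -> V) :
    (0 < P)%N -> (0 < Q)%N -> coprime P Q ->
  \sum_(0 <= a < P * Q) f (a %% P)%N (a %% Q)%N
  = \sum_(0 <= u < P) \sum_(0 <= v < Q) f u v.
Proof.
move=> P0 Q0 coPQ; have PQ0 : (0 < P * Q)%N by rewrite muln_gt0 P0.
rewrite !big_mkord; under [RHS]eq_bigr do rewrite big_mkord.
rewrite pair_big /=.
pose h (a : 'I_(P * Q)) := (Ordinal (ltn_pmod a P0), Ordinal (ltn_pmod a Q0)).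
pose h' (x : 'I_P * 'I_Q) := Ordinal (ltn_pmod (chinese P Q x.1 x.2) PQ0).
have hK : cancel h h'.
  by move=> a; apply: val_inj; rewrite /= -chinese_mod // modn_small.
have h'K : cancel h' h.
  case=> u v; congr (_, _); apply: val_inj => /=.
    by rewrite modn_dvdm ?dvdn_mulr // chinese_modl // modn_small.
  by rewrite modn_dvdm ?dvdn_mull // chinese_modr // modn_small.
by rewrite [RHS](reindex h) //; exists h' => x _.
Qed.
End NatSums.

(** * Power sums over quadratic classes modulo powers of [p] *)

Section RootSums.
Variables (R : comNzRingType) (p k : nat).
Hypotheses (p_pr : prime p) (pE : p = (4 * k).+3).

Let cardFp : #|'F_p| = (4 * k).+3.
Proof. by rewrite card_Fp. Qed.

Lemma N1_neq1_Fp : -1 != 1 :> 'F_p.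
Proof.
rewrite eq_sym -subr_eq0 opprK -[1 + 1]/(2%:R) -(dvdn_pcharf (pchar_Fp p_pr)).
by rewrite gtnNdvd // pE.
Qed.

Definition qclass e (a : nat) := qchar k (a%:R : 'F_p) == e.

Lemma qclassDl e a r : qclass e (p * a + r) = qclass e r.
Proof. by rewrite /qclass natrD natrM (pcharf0 (pchar_Fp p_pr)) mul0r add0r. Qed.

(* The p-part of chi_ij or chi_ij^*, according to the sign e. *)
Definition psum s i e (y : R) : R :=
  \sum_(0 <= u < p ^ s | (p ^ i %| u)%N && qclass e (u %/ p ^ i)%N) y ^+ u.

Definition ptail s i (y : R) : R :=
  \sum_(0 <= u < p ^ s | (p ^ i %| u)%N) y ^+ u.

Lemma sum_qclass (V : nmodType) e (f : nat -> V) :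
  \sum_(0 <= r < p | qclass e r) f r = \sum_(a : 'F_p | qchar k a == e) f a.
Proof.
rewrite -{1}(Fp_cast p_pr) big_mkord; apply: eq_bigl => a.
by rewrite /qclass natr_Zp.
Qed.

Lemma ptailE s i (y : R) : (i <= s)%N ->
  ptail s i y = \sum_(0 <= w < p ^ (s - i)) y ^+ (p ^ i * w).
Proof.
move=> le_is; rewrite /ptail -{1}(subnKC le_is) expnD.
under eq_bigl do rewrite -[(_ %| _)%N]andbT.
by rewrite (sum_nat_dvdn _ predT) // expn_gt0 prime_gt0.
Qed.

Section Products.
Variables (s i : nat) (y : R).
Hypotheses (lt_is : (i < s)%N) (y1 : y ^+ (p ^ s) = 1).

Let T := ptail s i.+1 y.

Let pS : (p ^ i.+1 * p ^ (s - i.+1) = p ^ s)%N.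
Proof. by rewrite -expnD subnKC. Qed.

(** Write [u = p ^ i * (p * w + r)]: the class depends on [r] alone, and summing over [w] produces
    the common factor [T]. *)
Lemma psumE e :
  psum s i e y = T * \sum_(a : 'F_p | qchar k a == e) y ^+ (p ^ i * a).
Proof.
rewrite /psum -pS expnSr -mulnA sum_nat_dvdn ?expn_gt0 ?prime_gt0 //.
rewrite sum_nat_modn; last by move=> w r; rewrite qclassDl.
rewrite sum_qclass mulr_sumr; apply: eq_bigr => a _.
rewrite /T ptailE // mulr_suml; apply: eq_bigr => w _.
by rewrite -exprD mulnDr expnSr mulnA.
Qed.

(** As [y ^+ (p ^ s) = 1], the factor only shifts the exponents in [T] cyclically among the
    multiples of [p ^ i.+1]. *)
Lemma ptail_mulX w : T * y ^+ (p ^ i.+1 * w) = T.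
Proof.
rewrite /T ptailE // mulr_suml.
under eq_bigr do rewrite -exprD -mulnDr.
rewrite (sum_nat_shift _ (f := fun w => y ^+ (p ^ i.+1 * w))) // => u.
by rewrite mulnDr pS exprD y1 mulr1.
Qed.

(** Next to [T], [y ^+ (p ^ i)] behaves like a [p]-th root of unity, so exponents can be read in
    ['F_p]. *)
Lemma ptail_mulXmod a : T * y ^+ (p ^ i * a) = T * y ^+ (p ^ i * (a %% p)).
Proof.
by rewrite {1}(divn_eq a p) mulnDr exprD mulrA mulnA mulnAC -expnSr ptail_mulX.
Qed.

(** Each of the [p ^ (s - i.+1)] terms of one factor is absorbed by the other. *)
Lemma ptail_sqr : T * T = T *+ p ^ (s - i.+1).
Proof.
rewrite {2}/T ptailE // mulr_sumr; under eq_bigr do rewrite ptail_mulX.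
by rewrite big_const_nat subn0 iter_addr_0.
Qed.

Lemma psum_mul e d :
  psum s i e y * psum s i d y
  = (\sum_(a : 'F_p | qchar k a == e) \sum_(b : 'F_p | qchar k b == d)
       T * y ^+ (p ^ i * (a + b)%R)) *+ p ^ (s - i.+1).
Proof.
rewrite !psumE mulrACA ptail_sqr mulrnAl; congr (_ *+ _).
rewrite [X in T * X]mulr_suml mulr_sumr; apply: eq_bigr => a _.
rewrite !mulr_sumr; apply: eq_bigr => b _; rewrite -exprD -mulnDr.
rewrite [LHS]ptail_mulXmod; congr (_ * _ ^+ (_ * _)).
by congr (_ %% _)%N; rewrite Fp_cast.
Qed.

Lemma psum_mul_same e : e ^+ 2 = 1 ->
  psum s i e y * psum s i e y = psum s i e y *+ (k * p ^ (s - i.+1))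
    + psum s i (- e) y *+ (k.+1 * p ^ (s - i.+1)).
Proof.
move=> e2; rewrite psum_mul.
rewrite (sum_qchar_add_same cardFp N1_neq1_Fp (fun c : 'F_p => T * y ^+ (p ^ i * c))) //.
by rewrite -!mulr_sumr -!psumE mulrnDl -!mulrnA.
Qed.

Lemma psum_mul_opp e : e ^+ 2 = 1 ->
  psum s i e y * psum s i (- e) y
  = (psum s i e y + psum s i (- e) y) *+ (k * p ^ (s - i.+1))
    + T *+ ((2 * k).+1 * p ^ (s - i.+1)).
Proof.
move=> e2; rewrite psum_mul.
rewrite (sum_qchar_add_opp cardFp N1_neq1_Fp (fun c : 'F_p => T * y ^+ (p ^ i * c))) //.
(* The sum 0 contributes [T * y ^+ 0 = T], which is the source of the tail term. *)
by rewrite -!mulr_sumr -!psumE muln0 mulr1 mulrnDl -!mulrnA.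
Qed.
End Products.

(** In a multiple [p ^ i * a], either [p] divides [a], giving the deeper tail, or [a] is in one of
    the two quadratic classes. *)
Lemma ptail_split s i e (y : R) : (i < s)%N -> e ^+ 2 = 1 ->
  ptail s i y = psum s i e y + psum s i (- e) y + ptail s i.+1 y.
Proof.
move=> lt_is e2; rewrite ptailE 1?ltnW // !psumE // -!mulrDr.
set T := ptail s i.+1 y.
transitivity (T * \sum_(a : 'F_p) y ^+ (p ^ i * a)).
  rewrite -(@subnSK i s) // expnS (sum_nat_modn _ (B := predT)) //=.
  rewrite -{1}(Fp_cast p_pr) big_mkord [RHS]mulr_sumr.
  apply: eq_bigr => a _; rewrite /T ptailE // mulr_suml; apply: eq_bigr => w _.
  by rewrite -exprD mulnDr expnSr mulnA.
rewrite (sum_qchar cardFp N1_neq1_Fp _ e2) /= muln0 expr0 -addrA mulrDr mulr1.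
exact: addrC.
Qed.
End RootSums.

(** * Exponents of prescribed [q]-adic valuation *)

Section PrimePowerGcd.
Variables (q t j : nat).
Hypotheses (q_pr : prime q) (le_jt : (j <= t)%N).

Lemma gcdn_pfactor v : (gcdn v (q ^ t) == q ^ j)%N
  = (q ^ j %| v)%N && coprime (v %/ q ^ j) (q ^ (t - j)).
Proof.
have qj0 : (0 < q ^ j)%N by rewrite expn_gt0 prime_gt0.
have [/dvdnP[w ->] | ndvd] := boolP (q ^ j %| v)%N; last first.
  by apply: contraNF ndvd => /eqP <-; apply: dvdn_gcdl.
rewrite mulnK // -{1}(subnK le_jt) expnD -muln_gcdl.
by rewrite -{2}[(q ^ j)%N]mul1n eqn_pmul2r.
Qed.

Lemma gcdn_pfactorDr v w : (j < t)%N -> (q ^ j.+1 %| w)%N ->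
  (gcdn (v + w) (q ^ t) == q ^ j)%N = (gcdn v (q ^ t) == q ^ j)%N.
Proof.
move=> lt_jt /dvdnP[x ->]; rewrite !gcdn_pfactor.
have qj0 : (0 < q ^ j)%N by rewrite expn_gt0 prime_gt0.
rewrite expnS mulnA dvdn_addl ?dvdn_mull //; case: dvdnP => //= -[w' ->].
rewrite -mulnDl !mulnK // !coprime_pexpr ?subn_gt0 // ![coprime _ q]coprime_sym.
by rewrite !prime_coprime // dvdn_addl // dvdn_mull.
Qed.
End PrimePowerGcd.

(** Phrasing valuation exactly [j] by a gcd also covers [j = t], where only [v = 0] remains. *)
Definition qsum (R : pzRingType) q t j (z : R) : R :=
  \sum_(0 <= v < q ^ t | (gcdn v (q ^ t) == q ^ j)%N) z ^+ v.

Lemma qsum_mul (R : comNzRingType) q t j j' (z : R) :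
    prime q -> (j < j')%N -> (j' <= t)%N -> z ^+ (q ^ t) = 1 ->
  qsum q t j z * qsum q t j' z = qsum q t j z *+ totient (q ^ (t - j')).
Proof.
move=> q_pr lt_jj' le_j't z1; have lt_jt := leq_trans lt_jj' le_j't.
have translate v : (gcdn v (q ^ t) == q ^ j')%N -> qsum q t j z * z ^+ v = qsum q t j z.
  rewrite gcdn_pfactor // => /andP[dv _].
  have {}dv : (q ^ j.+1 %| v)%N by apply: dvdn_trans dv; rewrite dvdn_exp2l.
  rewrite /qsum mulr_suml; under eq_bigr do rewrite -exprD.
  under eq_bigl do rewrite -(gcdn_pfactorDr q_pr (ltnW lt_jt) _ lt_jt dv).
  rewrite big_mkcond [RHS]big_mkcond /=.
  pose f u := if (gcdn u (q ^ t) == q ^ j)%N then z ^+ u else 0.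
  rewrite (sum_nat_shift v (f := f)) // => u.
  by rewrite /f exprD z1 mulr1 -gcdn_modl modnDr gcdn_modl.
(* Every term of the second factor reproduces the first one; it remains to count the exponents
   [q ^ j' * w] with [w] prime to [q ^ (t - j')]. *)
rewrite {2}/qsum mulr_sumr (eq_bigr _ translate).
under eq_bigl do rewrite gcdn_pfactor //.
rewrite -{1}(subnKC le_j't) expnD.
rewrite (sum_nat_dvdn _ (fun w => coprime w (q ^ (t - j')))) ?expn_gt0 ?prime_gt0 //.
rewrite totient_count_coprime big_mkcond -sumrMnr /=; apply: eq_bigr => w _.
by rewrite coprime_sym; case: coprime.
Qed.

(** * Splitting a root of unity along coprime moduli *)

Section ChineseSums.
Variables (R : comNzRingType) (P Q : nat) (x : R).
Hypotheses (P0 : (0 < P)%N) (Q0 : (0 < Q)%N) (coPQ : coprime P Q).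
Hypothesis x1 : x ^+ (P * Q) = 1.

Let x_mod a b : a = b %[mod P * Q] -> x ^+ a = x ^+ b.
Proof. by move=> ab; rewrite -(expr_mod a x1) ab expr_mod. Qed.

(** [y] and [z] are [x] raised to the two Chinese idempotents, so that
    [x ^+ a = y ^+ a * z ^+ a]. *)
Lemma chinese_sums : exists y z : R, [/\ y ^+ P = 1, z ^+ Q = 1 &
  forall B C : pred nat, (forall a, B (a %% P)%N = B a) ->
    (forall a, C (a %% Q)%N = C a) ->
  \sum_(0 <= a < P * Q | B a && C a) x ^+ a
  = (\sum_(0 <= u < P | B u) y ^+ u) * (\sum_(0 <= v < Q | C v) z ^+ v)].
Proof.
pose u := chinese P Q 1 0; pose v := chinese P Q 0 1.
have yP : (x ^+ u) ^+ P = 1.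
  rewrite -exprM -(expr0 x); apply: x_mod; apply/eqP.
  rewrite chinese_remainder // mod0n modnMl eqxx mod0n.
  by rewrite -modnMml (chinese_modr coPQ) mod0n mul0n mod0n /=.
have zQ : (x ^+ v) ^+ Q = 1.
  rewrite -exprM -(expr0 x); apply: x_mod; apply/eqP.
  rewrite chinese_remainder // !mod0n modnMl eqxx andbT.
  by rewrite -modnMml (chinese_modl coPQ) mod0n mul0n mod0n.
exists (x ^+ u), (x ^+ v); split=> // B C Bmod Cmod.
have xE a : x ^+ a = (x ^+ u) ^+ (a %% P) * (x ^+ v) ^+ (a %% Q).
  rewrite !expr_mod // -!exprM -exprD -mulnDl -{1}[a]mul1n; apply: x_mod.
  rewrite -[RHS]modnMml -[LHS]modnMml; congr ((_ * _) %% _)%N; apply/eqP.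
  rewrite chinese_remainder //; apply/andP; split; apply/eqP; rewrite -modnDm.
    by rewrite (chinese_modl coPQ) (chinese_modl coPQ) modnDm.
  by rewrite (chinese_modr coPQ) (chinese_modr coPQ) modnDm.
rewrite big_mkcond /=; under eq_bigr do rewrite xE -Bmod -Cmod.
pose f u v := if B u && C v then (x ^+ chinese P Q 1 0) ^+ u * (x ^+ chinese P Q 0 1) ^+ v else 0.
rewrite (sum_nat_chinese f P0 Q0 coPQ) mulr_suml [RHS]big_mkcond /=.
apply: eq_bigr => a _; rewrite /f; case: (B a) => /=; last by rewrite big1.
by rewrite mulr_sumr [RHS]big_mkcond.
Qed.
End ChineseSums.

(** * Membership in cyclotomic cosets *)

Section ResidueRings.
Variable m : nat.
Hypothesis m_gt1 : (1 < m)%N.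

Lemma eq_Zp_nat a b : (a%:R == b%:R :> 'Z_m) = (a == b %[mod m])%N.
Proof. by rewrite -val_eqE /= !val_Zp_nat. Qed.

Lemma big_Zp (V : nmodType) (B : pred nat) (f : nat -> V) :
  \sum_(a : 'Z_m | B a) f a = \sum_(0 <= a < m | B a) f a.
Proof. by rewrite -(big_mkord B f) Zp_cast. Qed.

(** Taking [n = p ^ s * q ^ t] lets one natural number replace [g] modulo both prime powers and
    modulo [n]. *)
Lemma intr_Zp_nat n (g : int) : (0 < n)%N -> (m %| n)%N ->
  g%:~R = `|(g %% n)%Z|%:R :> 'Z_m.
Proof.
move=> n0 /dvdnP[d nE]; rewrite [RHS]pmulrn gez0_abs ?modz_ge0 //; last first.
  by rewrite eqz_nat -lt0n.
rewrite {1}(divz_eq g n) intrD intrM [n%:~R](_ : _ = 0) ?mulr0 ?add0r //.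
by rewrite -pmulrn nE natrM pchar_Zp // mulr0.
Qed.

Lemma has_order_coprime c d : has_order_mod m c%:Z d -> coprime c m.
Proof.
move=> h; rewrite coprime_sym -unitZpE // -(unitrX_pos _ (prim_order_gt0 h)).
by rewrite (prim_expr_order h) unitr1.
Qed.

Lemma coprime_inv a : coprime a m -> exists b, (a * b = 1 %[mod m])%N.
Proof.
move=> am; have a_unit : (a%:R : 'Z_m) \is a GRing.unit by rewrite unitZpE // coprime_sym.
exists (a%:R^-1 : 'Z_m); apply/eqP; rewrite -eq_Zp_nat natrM.
by rewrite [X in _ * X]natr_Zp divrr.
Qed.
End ResidueRings.

(** * Residues reached by the powers of an element of known order *)

Section PrimitiveRootCover.
Variables (R : finNzRingType) (d : nat) (z : R) (A : {set R}).
Hypotheses (z_prim : d.-primitive_root z) (zA : forall r, z ^+ r \in A).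

Let B := [set z ^+ r | r : 'I_d].

Let sBA : B \subset A.
Proof. by apply/subsetP => _ /imsetP[r _ ->]. Qed.

Let cardB : #|B| = d.
Proof.
rewrite card_imset ?card_ord // => a b /eqP.
by rewrite (eq_prim_root_expr z_prim) !modn_small // => /eqP/val_inj.
Qed.

Lemma prim_root_leq_card : (d <= #|A|)%N.
Proof. by rewrite -cardB subset_leq_card. Qed.

(** The [d] distinct powers all lie in [A], so a bound of [d] on its size leaves room for nothing
    else. *)
Lemma prim_root_cover w : (#|A| <= d)%N -> w \in A -> exists r, w = z ^+ r.
Proof.
move=> leA; have -> : A = B by apply/esym/eqP; rewrite eqEcard sBA cardB.
by case/imsetP => r _ ->; exists r.
Qed.
End PrimitiveRootCover.

Lemma primitive_root_power m (l w : nat) : (1 < m)%N ->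
    has_order_mod m l%:Z (totient m) -> coprime w m ->
  exists r, l ^ r = w %[mod m].
Proof.
move=> m_gt1 l_ord wm; pose U := [set x : 'Z_m | coprime m x].
have lU r : (l%:~R ^+ r : 'Z_m) \in U.
  rewrite -pmulrn -natrX inE val_Zp_nat // coprime_modr coprimeXr // coprime_sym.
  exact: has_order_coprime l_ord.
have leU : (#|U| <= totient m)%N.
  rewrite -sum1_card; under eq_bigl do rewrite inE.
  rewrite (big_Zp m_gt1 (coprime m) (fun=> 1%N)) totient_count_coprime.
  by rewrite big_mkcond; apply/eq_leq/eq_bigr => x _; case: coprime.
have wU : (w%:R : 'Z_m) \in U by rewrite inE val_Zp_nat // coprime_modr coprime_sym.
have [r wE] := prim_root_cover l_ord lU leU wU.
by exists r; apply/eqP; rewrite -eq_Zp_nat // wE -pmulrn natrX.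
Qed.

Arguments qclass p k e a : clear implicits.
Arguments psum {R} p k s i e y.

Section PrimeThreeModFour.
Variables (p k : nat).
Hypotheses (p_pr : prime p) (pE : p = (4 * k).+3).

Let cardFp : #|'F_p| = (4 * k).+3.
Proof. by rewrite card_Fp. Qed.

Lemma totient_pfactor_half s : (0 < s)%N ->
  totient (p ^ s) = (2 * ((2 * k).+1 * p ^ s.-1))%N.
Proof. by move=> s0; rewrite totient_pfactor // mulnA; congr (_ * _)%N; lia. Qed.

Lemma odd_half_totient s : odd ((2 * k).+1 * p ^ s).
Proof. by rewrite oddM oddX pE /= !oddM /= orbT. Qed.

Lemma qclass_mod e a b : a = b %[mod p] -> qclass p k e a = qclass p k e b.
Proof. by move=> ab; rewrite /qclass -(Fp_nat_mod p_pr a) ab Fp_nat_mod. Qed.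

Lemma Fp_nat_eq0 a : (a%:R == 0 :> 'F_p) = (p %| a)%N.
Proof. by rewrite -(dvdn_pcharf (pchar_Fp p_pr)). Qed.

Lemma Fp_nat_neq0 a : coprime a p -> a%:R != 0 :> 'F_p.
Proof. by rewrite Fp_nat_eq0 -prime_coprime // coprime_sym. Qed.

Lemma qclass1X a r : qclass p k 1 a -> qclass p k 1 (a ^ r).
Proof. by rewrite /qclass natrX qcharX => /eqP->; rewrite expr1n. Qed.

Variable s : nat.
Hypothesis s_gt0 : (0 < s)%N.

Let P := (p ^ s)%N.

Let P_gt1 : (1 < P)%N.
Proof. by rewrite -(exp1n s) ltn_exp2r // prime_gt1. Qed.

Let totientP := totient_pfactor_half s_gt0.

Let halfP : (totient P %/ 2 = (2 * k).+1 * p ^ s.-1)%N.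
Proof. by rewrite totientP mulKn. Qed.

Lemma eq_mod_expn a b : a = b %[mod p ^ s] -> a = b %[mod p].
Proof.
have pP : (p %| P)%N by rewrite /P -(prednK s_gt0) expnS dvdn_mulr.
by move=> ab; rewrite -(modn_dvdm a pP) ab modn_dvdm.
Qed.

Let S := [set w : 'Z_P | qclass p k 1 w].

(** There are [2k+1] nonzero squares modulo [p], each with [p ^ s.-1] lifts. *)
Let cardS : #|S| = (totient P %/ 2)%N.
Proof.
rewrite halfP -sum1_card; under eq_bigl do rewrite inE.
rewrite (big_Zp P_gt1 (qclass p k 1) (fun=> 1%N)) /P -(prednK s_gt0) expnS.
rewrite sum_nat_modn => [|w r]; last exact: qclassDl.
rewrite (sum_qclass k p_pr) sumr_const_nat sumr_const -mulrnA natn subn0 mulnC.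
congr (_ * _)%N.
by rewrite -(card_qchar cardFp (N1_neq1_Fp p_pr pE) (expr1n _ 2)) cardsE.
Qed.

Let mem_S a r : ((a%:R ^+ r : 'Z_P) \in S) = qclass p k 1 (a ^ r).
Proof.
rewrite inE -natrX val_Zp_nat //; apply: qclass_mod; apply: eq_mod_expn.
by rewrite modn_mod.
Qed.

(** Half the totient is [(2k+1) * p ^ s.-1], so the character of [l] has [p ^ s.-1]-th power 1; this
    exponent is odd, which excludes -1. *)
Lemma qclass_half_order l :
  has_order_mod (p ^ s) l%:Z (totient (p ^ s) %/ 2) -> qclass p k 1 l.
Proof.
move=> l_ord; have /eqP := prim_expr_order l_ord.
rewrite halfP -pmulrn -natrX -[1]/(1%:R) (eq_Zp_nat P_gt1) => /eqP/eq_mod_expn ld.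
have l0 : l%:R != 0 :> 'F_p.
  by apply: Fp_nat_neq0; have := has_order_coprime P_gt1 l_ord; rewrite coprime_pexpr.
have /eqP : qchar k (l%:R : 'F_p) ^+ (p ^ s.-1) = 1.
  by rewrite /qchar -exprM -natrX -(Fp_nat_mod p_pr) ld Fp_nat_mod.
have := qchar_sign cardFp l0; rewrite /qclass => /orP[] // /eqP ->.
by rewrite -signr_odd oddX pE /= !oddM /= orbT expr1.
Qed.

(** A square [g] would have all its [totient (p ^ s)] distinct powers in the set [S] of half that
    size. *)
Lemma qclass_primitive_root g :
  has_order_mod (p ^ s) g%:Z (totient (p ^ s)) -> qclass p k (-1) g.
Proof.
move=> g_ord; have g0 : g%:R != 0 :> 'F_p.
  by apply: Fp_nat_neq0; have := has_order_coprime P_gt1 g_ord; rewrite coprime_pexpr.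
have := qchar_sign cardFp g0; rewrite /qclass => /orP[g1|//].
have gS r : (g%:~R ^+ r : 'Z_P) \in S by rewrite -pmulrn mem_S qclass1X.
have := prim_root_leq_card g_ord gS.
rewrite cardS halfP totientP leqNgt ltn_Pmull //.
by rewrite muln_gt0 expn_gt0 (prime_gt0 p_pr).
Qed.

(** The powers of [l] stay in [S], whose size equals the order of [l]. *)
Lemma half_order_power (l w : nat) :
    has_order_mod (p ^ s) l%:Z (totient (p ^ s) %/ 2) -> qclass p k 1 w ->
  exists r, l ^ r = w %[mod p ^ s].
Proof.
move=> l_ord w1.
have lS r : (l%:~R ^+ r : 'Z_P) \in S.
  by rewrite -pmulrn mem_S qclass1X ?(qclass_half_order l_ord).
have wS : (w%:R : 'Z_P) \in S by rewrite -[_%:R]expr1 mem_S expn1.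
have [|r wE] := prim_root_cover l_ord lS _ wS; first by rewrite cardS.
by exists r; apply/eqP; rewrite -(eq_Zp_nat P_gt1) wE -pmulrn natrX.
Qed.
End PrimeThreeModFour.

Section CyclotomicCosets.
Variables (p q k s t l : nat).
Hypotheses (p_pr : prime p) (q_pr : prime q) (neq_pq : p <> q).
Hypotheses (pE : p = (4 * k).+3) (s_gt0 : (0 < s)%N) (t_gt0 : (0 < t)%N).
Hypotheses (l_ordP : has_order_mod (p ^ s) l%:Z (totient (p ^ s) %/ 2))
  (l_ordQ : has_order_mod (q ^ t) l%:Z (totient (q ^ t))).
Hypothesis gcd2 : gcdn (totient (p ^ s)) (totient (q ^ t)) = 2%N.

Let P := (p ^ s)%N.
Let Q := (q ^ t)%N.

Let P_gt1 : (1 < P)%N.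
Proof. by rewrite -(exp1n s) ltn_exp2r // prime_gt1. Qed.

Let Q_gt1 : (1 < Q)%N.
Proof. by rewrite -(exp1n t) ltn_exp2r // prime_gt1. Qed.

Let co_pq : coprime p q.
Proof. by rewrite prime_coprime // dvdn_prime2 //; apply/eqP. Qed.

Let coPQ : coprime P Q.
Proof. by rewrite coprimeXl // coprimeXr. Qed.

Let n_gt1 : (1 < P * Q)%N.
Proof. by rewrite (leq_trans P_gt1) // leq_pmulr // ltnW. Qed.

(* The orders of l at p and q are coprime, the former being odd. *)
Lemma power_of_l w1 w2 : qclass p k 1 w1 -> coprime w2 q ->
  exists r, l ^ r = w1 %[mod P] /\ l ^ r = w2 %[mod Q].
Proof.
move=> w1S w2q.
have [r1 r1E] := half_order_power p_pr pE s_gt0 l_ordP w1S.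
have [r2 r2E] := primitive_root_power Q_gt1 l_ordQ (coprimeXr t w2q).
have co12 : coprime (totient P %/ 2) (totient Q).
  move: gcd2; rewrite (totient_pfactor_half p_pr pE) // mulKn // => gcd2'.
  rewrite /coprime -dvdn1 -(@Gauss_dvdl _ 1 2).
    by rewrite mul1n -[X in (_ %| X)%N]gcd2' dvdn_gcd dvdn_gcdr dvdn_mull ?dvdn_gcdl.
  rewrite coprimen2; have := odd_half_totient pE s.-1; apply: contraTT.
  by rewrite -!dvdn2 => /dvdn_trans; apply; apply: dvdn_gcdl.
exists (chinese (totient P %/ 2) (totient Q) r1 r2); split; apply/eqP.
  rewrite -r1E -(eq_Zp_nat P_gt1) !natrX -(prim_expr_mod l_ordP).
  by rewrite (chinese_modl co12) (prim_expr_mod l_ordP).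
rewrite -r2E -(eq_Zp_nat Q_gt1) !natrX -(prim_expr_mod l_ordQ).
by rewrite (chinese_modr co12) (prim_expr_mod l_ordQ).
Qed.

Lemma coset_natP c (a : 'Z_(P * Q)) :
  reflect (exists r, a = c * l ^ r %[mod P * Q])
          (a \in cyclotomic_coset (P * Q) l c%:Z).
Proof.
have E r : ((a : 'Z_(P * Q)) == c%:~R * l%:R ^+ r) = (a == c * l ^ r %[mod P * Q])%N.
  by rewrite -pmulrn -natrX -natrM -{1}[a]natr_Zp eq_Zp_nat.
apply: (iffP (@cyclotomic_cosetP _ l c a)) => -[r h]; exists r; apply/eqP.
  by rewrite -E h.
by rewrite E; apply/eqP.
Qed.

Lemma qgcd_coset i j u r : coprime u q -> (j <= t)%N ->
  gcdn (p ^ i * q ^ j * u * l ^ r) Q = (q ^ j)%N.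
Proof.
move=> uq le_jt.
have cQ x : coprime x q -> coprime Q x by move=> xq; rewrite coprime_sym coprimeXr.
have lq : coprime l q by have := has_order_coprime Q_gt1 l_ordQ; rewrite coprime_pexpr.
rewrite gcdnC Gauss_gcdl ?cQ ?coprimeXl // Gauss_gcdl ?cQ //.
rewrite Gauss_gcdr ?cQ ?coprimeXl //.
by apply/gcdn_idPr; rewrite dvdn_exp2l.
Qed.

(* The converse half of the membership criteria: it remains to provide the
   component of the power of l at p. *)
Lemma mem_coset i j u w (a : 'Z_(P * Q)) : coprime u q -> (j <= t)%N ->
    qclass p k 1 w -> p ^ i * q ^ j * u * w = a %[mod P] ->
    gcdn a Q = (q ^ j)%N ->
  a \in cyclotomic_coset (P * Q) l (p ^ i * q ^ j * u)%N%:Z.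
Proof.
move=> uq le_jt w1 aP /eqP; rewrite gcdn_pfactor // => /andP[/dvdnP[b aE] bq].
have qj0 : (0 < q ^ j)%N by rewrite expn_gt0 prime_gt0.
rewrite aE mulnK // in bq.
have [w2 w2q w2E] : exists2 w2, coprime w2 q &
    p ^ i * q ^ j * u * w2 = a %[mod Q].
  move: le_jt; rewrite leq_eqVlt => /predU1P[jt|lt_jt].
    (* For [j = t] both sides vanish modulo [Q], so any unit would do. *)
    exists 1%N; first exact: coprime1n.
    by rewrite aE jt -!mulnA mulnCA modnMl modnMr.
  rewrite coprime_pexpr ?subn_gt0 // in bq.
  have puq : coprime (p ^ i * u) Q by rewrite coprimeXr // coprimeMl coprimeXl.
  have [e eE] := coprime_inv Q_gt1 puq.
  (* [b] is the cofactor of [q ^ j] in [a], and [e] inverts [p ^ i * u] modulo [Q]. *)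
  exists (b * e)%N.
    rewrite coprimeMl bq /=.
    have : coprime (p ^ i * u * e) Q by rewrite -coprime_modl eE coprime_modl coprime1n.
    by rewrite coprimeMl => /andP[_]; rewrite coprime_pexpr.
  rewrite aE (_ : _ * _ = (p ^ i * u * e) * (b * q ^ j))%N; last first.
    by rewrite -!mulnA; congr (_ * _)%N; rewrite mulnCA (mulnC (q ^ j)%N); lia.
  by rewrite -modnMml eE modnMml mul1n.
have [r [rP rQ]] := power_of_l w1 w2q.
apply/coset_natP; exists r; apply/eqP; rewrite chinese_remainder //.
by rewrite -aP -w2E -(modnMmr _ (l ^ r)) rP modnMmr eqxx -(modnMmr _ (l ^ r)) rQ modnMmr eqxx.
Qed.

(** Cancelling [p ^ i] leaves [q ^ j * u * l ^ r] modulo [p], where [l] has character 1; [i < s]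
    ensures that a factor [p] remains in the modulus. *)
Lemma mem_coset_lt i j u (a : 'Z_(P * Q)) : (i < s)%N -> (j <= t)%N ->
    coprime u p -> coprime u q ->
  (a \in cyclotomic_coset (P * Q) l (p ^ i * q ^ j * u)%N%:Z)
  = ((p ^ i %| a)%N && qclass p k (qchar k q%:R ^+ j * qchar k u%:R) (a %/ p ^ i)%N)
    && (gcdn a Q == q ^ j)%N.
Proof.
move=> lt_is le_jt up uq.
have pi0 : (0 < p ^ i)%N by rewrite expn_gt0 prime_gt0.
have qp : coprime q p by rewrite coprime_sym.
have PE : P = (p ^ i * (p ^ (s - i.+1) * p))%N.
  by rewrite /P -expnSr -expnD subnSK // subnKC // ltnW.
have pi_dvd : (p ^ i %| P * Q)%N by rewrite PE -!mulnA dvdn_mulr.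
have piS_dvd : (p ^ i * p %| P * Q)%N by rewrite dvdn_mulr // PE dvdn_mul // dvdn_mull.
apply/idP/idP => [/coset_natP[r aE] | /andP[/andP[/dvdnP[b ab] be] /eqP aQ]].
  have aQ : gcdn a Q = (q ^ j)%N.
    rewrite -(qgcd_coset i r uq le_jt) -gcdn_modl -(modn_dvdm a (dvdn_mull P (dvdnn Q))).
    by rewrite aE modn_dvdm ?dvdn_mull // gcdn_modl.
  rewrite aQ eqxx andbT.
  have /dvdnP[b ab] : (p ^ i %| a)%N.
    by rewrite /dvdn -(modn_dvdm _ pi_dvd) aE modn_dvdm // -!mulnA modnMr.
  rewrite ab dvdn_mull //= mulnK //.
  have : b * p ^ i = q ^ j * u * l ^ r * p ^ i %[mod p * p ^ i].
    rewrite (mulnC p) -(modn_dvdm _ piS_dvd) -ab aE modn_dvdm //.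
    by rewrite (mulnC _ (p ^ i)%N) !mulnA.
  move/eqP; rewrite -!muln_modl eqn_pmul2r // => /eqP bE.
  rewrite (qclass_mod k p_pr _ bE) /qclass !natrM !natrX !qcharM !qcharX.
  by rewrite (eqP (qclass_half_order p_pr pE s_gt0 l_ordP)) expr1n mulr1.
have [e eE] : exists e, q ^ j * u * e = 1 %[mod P].
  by apply: coprime_inv; rewrite // coprimeMl coprimeXl ?coprimeXr.
(* [e] inverts [q ^ j * u], which has the same character as [b]; hence [b * e] is a square modulo
   [p]. *)
apply: (mem_coset (w := (b * e)%N)) => //.
  rewrite ab mulnK // /qclass in be; have := qclass_mod k p_pr 1 (eq_mod_expn s_gt0 eE).
  rewrite /qclass !natrM !natrX !qcharM !qcharX (eqP be) qchar1 eqxx => /eqP/eqP.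
  by [].
rewrite (_ : _ * _ = q ^ j * u * e * (b * p ^ i))%N; last by lia.
by rewrite -ab -modnMml eE modnMml mul1n.
Qed.

(** At [i = s] the component modulo [p ^ s] is 0, so no character condition survives and [w = 1]
    serves. *)
Lemma mem_coset_last j (a : 'Z_(P * Q)) : (j <= t)%N ->
  (a \in cyclotomic_coset (P * Q) l (p ^ s * q ^ j)%N%:Z)
  = (p ^ s %| a)%N && (gcdn a Q == q ^ j)%N.
Proof.
move=> le_jt; have P_dvd : (P %| P * Q)%N by rewrite dvdn_mulr.
rewrite -[(_ * q ^ j)%N]muln1.
apply/idP/idP => [/coset_natP[r aE] | /andP[Pa /eqP aQ]]; last first.
  apply: (mem_coset (w := 1)) => //; first exact: coprime1n.
    by rewrite /qclass qchar1.
  by rewrite (eqP Pa) -!mulnA modnMr.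
have aQ : gcdn a Q = (q ^ j)%N.
  rewrite -(qgcd_coset s r (coprime1n q) le_jt) -gcdn_modl.
  rewrite -(modn_dvdm a (dvdn_mull P (dvdnn Q))).
  by rewrite aE modn_dvdm ?dvdn_mull // gcdn_modl.
by rewrite aQ eqxx andbT /dvdn -(modn_dvdm _ P_dvd) aE modn_dvdm // -!mulnA modnMr.
Qed.

(** * Coset sums as products over the two prime powers *)

Lemma coset_sum_eq gamma gamma' :
    gamma%:~R = gamma'%:~R :> 'Z_(P * Q) ->
  coset_sum (P * Q) l gamma = coset_sum (P * Q) l gamma'.
Proof. by move=> E; rewrite /coset_sum /cyclotomic_coset E. Qed.

(** The same [y] and [z] serve for all [i], [j] and [u], so products of coset sums can be computed
    on each factor separately. *)
Lemma coset_sums_factor : exists y z : cyc_ring l (P * Q),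
  [/\ y ^+ P = 1, z ^+ Q = 1,
      forall i j u, (i < s)%N -> (j <= t)%N -> coprime u p -> coprime u q ->
        coset_sum (P * Q) l (p ^ i * q ^ j * u)%N%:Z
        = psum p k s i (qchar k q%:R ^+ j * qchar k u%:R) y * qsum q t j z
    & forall j, (j <= t)%N ->
        coset_sum (P * Q) l (p ^ s * q ^ j)%N%:Z = ptail p s s y * qsum q t j z].
Proof.
pose x : cyc_ring l (P * Q) := in_qpoly _ 'X.
have x1 : x ^+ (P * Q) = 1.
  apply/eqP; rewrite -subr_eq0 -rmorphXn -(rmorph1 (in_qpoly _)) -rmorphB /=.
  apply/eqP/val_inj; rewrite /= mk_monic_Xn_sub1 ?(ltnW n_gt1) //.
  by apply: Pdiv.RingMonic.rmodpp; rewrite monicXnsubC // ltnW.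
have [y [z [y1 z1 E]]] := chinese_sums (ltnW P_gt1) (ltnW Q_gt1) coPQ x1.
have Qmod j a : (gcdn (a %% Q) Q == q ^ j)%N = (gcdn a Q == q ^ j)%N.
  by rewrite gcdn_modl.
have sumE (B : pred nat) gamma :
    (forall a : 'Z_(P * Q), (a \in cyclotomic_coset (P * Q) l gamma) = B a) ->
  coset_sum (P * Q) l gamma = \sum_(0 <= a < P * Q | B a) x ^+ a.
  move=> BE; rewrite -(big_Zp n_gt1 B (fun a => x ^+ a)).
  by apply: eq_big => // a _; rewrite -rmorphXn.
exists y, z; split=> // [i j u lt_is le_jt up uq | j le_jt].
  pose B a := (p ^ i %| a)%N
    && qclass p k (qchar k q%:R ^+ j * qchar k u%:R) (a %/ p ^ i)%N.
  pose C a := (gcdn a Q == q ^ j)%N.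
  rewrite (sumE (fun a => B a && C a) _ (fun a => mem_coset_lt a lt_is le_jt up uq)).
  apply: (E B C) => a; last exact: Qmod.
  rewrite /B.
  have pi_dvd : (p ^ i %| P)%N by rewrite dvdn_exp2l // ltnW.
  rewrite divn_modl // {1}/dvdn modn_dvdm //; congr (_ && _); apply: (qclass_mod k p_pr).
  (* Reducing modulo [P] changes the quotient by a multiple of [p ^ (s - i)], hence of [p]. *)
  rewrite modn_dvdm // /P -expnB ?prime_gt0 ?(ltnW lt_is) //.
  by rewrite -(subnSK lt_is) expnS dvdn_mulr.
pose B a := (p ^ s %| a)%N; pose C a := (gcdn a Q == q ^ j)%N.
rewrite (sumE (fun a => B a && C a) _ (fun a => mem_coset_last a le_jt)).
apply: (E B C) => a; last exact: Qmod.
by rewrite /B /dvdn modn_mod.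
Qed.
End CyclotomicCosets.

(** Iterating [ptail_split] peels off the levels from [i] up to [s - 1]; the induction is on
    [s - i]. *)
Lemma ptail_sum (R : comNzRingType) p k s i e (y : R) : prime p ->
    p = (4 * k).+3 -> (i <= s)%N -> e ^+ 2 = 1 ->
  ptail p s i y
  = \sum_(i <= m < s) (psum p k s m e y + psum p k s m (- e) y) + ptail p s s y.
Proof.
move=> p_pr pE le_is e2; rewrite -(subKn le_is).
elim: (s - i)%N (leq_subr i s) => [|d IHd] lt_ds.
  by rewrite subn0 big_geq // add0r.
have lt_s : (s - d.+1 < s)%N by rewrite ltn_subrL (leq_trans _ lt_ds).
rewrite big_ltn // -addrA (ptail_split p_pr pE y lt_s e2) subnSK //.
by rewrite -IHd // ltnW.
Qed.

(** * Residuosity of [q] and the product formulas *)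

Section QuadraticCharacter.
Variables (p k q : nat).
Hypotheses (p_pr : prime p) (pE : p = (4 * k).+3).

Let eq_Fp_nat a b : (a%:R == b%:R :> 'F_p) = (a == b %[mod p])%N.
Proof. by rewrite -(eq_Zp_nat (prime_gt1 p_pr)) -val_eqE /= pdiv_id. Qed.

Lemma qchar_residue : quadratic_residue p q -> qchar k (q%:R : 'F_p) = 1.
Proof.
have cardFp : #|'F_p| = (4 * k).+3 by rewrite card_Fp.
case=> qp [x /eqP]; rewrite -eq_Fp_nat natrX => /eqP xq.
apply/eqP/(qchar_sqrtP cardFp); exists x%:R => //.
rewrite -sqrf_eq0 xq (Fp_nat_eq0 p_pr) -prime_coprime // coprime_sym.
exact: qp.
Qed.

Lemma qchar_nonresidue : quadratic_nonresidue p q -> qchar k (q%:R : 'F_p) = -1.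
Proof.
have cardFp : #|'F_p| = (4 * k).+3 by rewrite card_Fp.
case=> qp nsq; have q0 : (q%:R : 'F_p) != 0.
  by rewrite (Fp_nat_eq0 p_pr) -prime_coprime // coprime_sym.
have /orP[/(qchar_sqrtP cardFp)[y _ qy]|/eqP//] := qchar_sign cardFp q0.
case: nsq; exists (y : nat); apply/eqP; rewrite -eq_Fp_nat natrX qy.
by rewrite [y%:R]natr_Zp.
Qed.
End QuadraticCharacter.

Theorem theorem4p9 (s t p q l : nat) (g : int) (i j j' : nat)
    (hs : (1 <= s)%N) (ht : (1 <= t)%N)
    (hp : prime p) (hq : prime q) (hl : prime l)
    (hpq : p <> q) (hpl : p <> l) (hql : q <> l)
    (p_odd : odd p) (q_odd : odd q)
    (hp34 : p = 3 %[mod 4])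
    (hlp : has_order_mod (p ^ s) l%:Z (totient (p ^ s) %/ 2))
    (hlq : has_order_mod (q ^ t) l%:Z (totient (q ^ t)))
    (hgcd : gcdn (totient (p ^ s)) (totient (q ^ t)) = 2%N)
    (hgp : primitive_root_mod (p ^ s) g)
    (hgq : primitive_root_mod (q ^ t) g)
    (hi : (i <= s - 1)%N) (hjj' : (j < j')%N) (hj't : (j' <= t)%N) :
  let X := chi p q s t l in
  let Y := chi_star p q s t l g in
  let c (N : nat) : 'F_l := N%:R in
  [/\ quadratic_residue p q ->
        Y i j * Y i j' =
          c ((p - 3) %/ 4 * p ^ (s - i - 1) * totient (q ^ (t - j')))%N *: Y i j
        + c ((p + 1) %/ 4 * p ^ (s - i - 1) * totient (q ^ (t - j')))%N *: X i j,
      quadratic_nonresidue p q -> (2 %| j' - j)%N ->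
        Y i j * Y i j' =
          c ((p - 3) %/ 4 * p ^ (s - i - 1) * totient (q ^ (t - j')))%N *: Y i j
        + c ((p + 1) %/ 4 * p ^ (s - i - 1) * totient (q ^ (t - j')))%N *: X i j
    & quadratic_nonresidue p q -> ~~ (2 %| j' - j)%N ->
        Y i j * Y i j' =
          c ((p - 3) %/ 4 * p ^ (s - i - 1) * totient (q ^ (t - j')))%N
            *: (X i j + Y i j)
        + c (totient (p ^ (s - i)) %/ 2 * totient (q ^ (t - j')))%N
            *: (\sum_(i.+1 <= k < s) (X k j + Y k j) + X s j)].
Proof.
have [k pE] : exists k, p = (4 * k).+3.
  by exists (p %/ 4)%N; rewrite {1}(divn_eq p 4) hp34 mulnC addn3.
have i_lt_s : (i < s)%N by rewrite (leq_ltn_trans hi) // subn1 ltn_predL.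
have le_jt : (j <= t)%N by rewrite ltnW // (leq_trans hjj').
have Q_gt1 : (1 < q ^ t)%N by rewrite -(exp1n t) ltn_exp2r // prime_gt1.
have P_gt1 : (1 < p ^ s)%N by rewrite -(exp1n s) ltn_exp2r // prime_gt1.
have n_gt0 : (0 < p ^ s * q ^ t)%N by rewrite muln_gt0 (ltnW P_gt1) (ltnW Q_gt1).
have cardFp : #|'F_p| = (4 * k).+3 by rewrite card_Fp.
(* The coset criteria take natural multipliers, so [g] is replaced by its remainder modulo
   [p ^ s * q ^ t]. *)
set g' := `|(g %% (p ^ s * q ^ t)%N)%Z|%N.
have gE m : (1 < m)%N -> (m %| p ^ s * q ^ t)%N -> g%:~R = g'%:R :> 'Z_m.
  by move=> m1 dm; apply: intr_Zp_nat.
have gP : has_order_mod (p ^ s) g'%:Z (totient (p ^ s)).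
  by move: hgp; rewrite /primitive_root_mod /has_order_mod gE ?dvdn_mulr // -pmulrn.
have gQ : has_order_mod (q ^ t) g'%:Z (totient (q ^ t)).
  by move: hgq; rewrite /primitive_root_mod /has_order_mod gE ?dvdn_mull // -pmulrn.
have gp : coprime g' p by have := has_order_coprime P_gt1 gP; rewrite coprime_pexpr.
have gq : coprime g' q by have := has_order_coprime Q_gt1 gQ; rewrite coprime_pexpr.
have [y [z [y1 z1 fact fact_last]]] :=
  coset_sums_factor hp hq hpq pE hs ht hlp hlq hgcd.
have qg : qchar k (g'%:R : 'F_p) = -1.
  by apply/eqP/(qclass_primitive_root hp pE hs gP).
move=> X Y c.
(* [e m] is the sign of [X i m]; that of [Y i m] is [- e m], because the primitive root [g] is a
   nonsquare modulo [p]. *)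
pose e m : 'F_p := qchar k q%:R ^+ m.
have XE m r : (m < s)%N -> (r <= t)%N -> X m r = psum p k s m (e r) y * qsum q t r z.
  move=> ms rt; rewrite /X /chi -[(_ * _ ^ r)%N]muln1 fact ?coprime1n //.
  by rewrite qchar1 mulr1.
have YE m r : (m < s)%N -> (r <= t)%N -> Y m r = psum p k s m (- e r) y * qsum q t r z.
  move=> ms rt; have -> : - e r = e r * qchar k g'%:R by rewrite qg mulrN1.
  rewrite /Y /chi_star -fact //.
  apply: coset_sum_eq; rewrite intrM gE //; last first.
    by rewrite (leq_trans P_gt1) // leq_pmulr // ltnW.
  by rewrite -!pmulrn -natrM.
have XsE r : (r <= t)%N -> X s r = ptail p s s y * qsum q t r z.
  by move=> rt; rewrite /X /chi fact_last.
have sqE r : e r ^+ 2 = 1.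
  rewrite /e exprAC qchar_sqr ?expr1n // Fp_nat_eq0 // dvdn_prime2 //; exact/eqP.
have k1 : ((p - 3) %/ 4 = k)%N by lia.
have k2 : ((p + 1) %/ 4 = k.+1)%N by lia.
have sq : qsum q t j z * qsum q t j' z = qsum q t j z *+ totient (q ^ (t - j')).
  exact: qsum_mul.
(* Cases (i) and (ii) share this computation: equal signs make the product of the [p]-parts a
   square. *)
have same : e j = e j' ->
    Y i j * Y i j' =
      c ((p - 3) %/ 4 * p ^ (s - i - 1) * totient (q ^ (t - j')))%N *: Y i j
    + c ((p + 1) %/ 4 * p ^ (s - i - 1) * totient (q ^ (t - j')))%N *: X i j.
  move=> ej; rewrite !YE // XE // mulrACA sq -ej.
  rewrite (psum_mul_same hp pE i_lt_s y1) ?sqrrN // opprK k1 k2 -subnDA addn1.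
  by rewrite /c !scaler_nat mulrnAr mulrDl !mulrnAl mulrnDl -!mulrnA.
split=> [res | nres even_jj | nres odd_jj].
- by apply: same; rewrite /e (qchar_residue hp pE res) !expr1n.
- apply: same; rewrite /e (qchar_nonresidue hp pE nres).
  by rewrite -(subnKC (ltnW hjj')) exprD -[X in _ * X]signr_odd -[odd _]negbK -dvdn2 even_jj mulr1.
(* In case (iii) the signs are opposite, so the product of the [p]-parts involves the tail. *)
have ej : e j' = - e j.
  rewrite /e (qchar_nonresidue hp pE nres) -(subnKC (ltnW hjj')) exprD.
  by rewrite -[X in _ * X]signr_odd -[odd _]negbK -dvdn2 odd_jj mulrN1.
(* At each level above [i], [X] and [Y] carry the two opposite signs, so together they rebuild the
   tail; [X s j] is its last level. *)
have tailE : \sum_(i.+1 <= m < s) (X m j + Y m j) + X s j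
    = ptail p s i.+1 y * qsum q t j z.
  rewrite (ptail_sum y hp pE i_lt_s (sqE j)) mulrDl XsE // [X in _ = X + _]mulr_suml; congr (_ + _).
  by apply: eq_big_nat => m /andP[_ ms]; rewrite XE // YE // mulrDl.
have halfE : (totient (p ^ (s - i)) %/ 2 = (2 * k).+1 * p ^ (s - i.+1))%N.
  by rewrite (totient_pfactor_half hp pE) ?subn_gt0 // mulKn // subnS.
rewrite tailE YE // YE // XE // mulrACA sq ej.
rewrite (psum_mul_opp hp pE i_lt_s y1) ?sqrrN // opprK halfE k1 -subnDA addn1.
rewrite /c !scaler_nat mulrnAr mulrDl !mulrnAl mulrnDl -!mulrnA.
by rewrite [X in X * _]addrC -mulrDl.
Qed.
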